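(* Let $\mathcal A$ be countably infinite, and let $\Sigma_{\mathcal A}$ be the OTW full shift with the shift map $\sigma$. Fix a prefix--shift compatible enumeration $\mathcal P=\{p_1,p_2,\dots\}$ of $\Sigma_{\mathcal A}^{\mathrm{fin}}$ and write $d_0:=d_{\mathcal P}$ for the associated OTW metric. Then $(\Sigma_{\mathcal A},\sigma,d_0)$ has the Lipschitz shadowing property. In fact, one may take Lipschitz constant $L=2$.
   Context: Let $\Sigma_{\mathcal A}^{\mathrm{fin}}:=\{\tilde 0\}\cup\bigcup_{k\ge1}\mathcal A^k$ be the set of finite words over $\mathcal A$, where $\tilde 0$ is the empty word, and $\mathcal A^{\mathbb N}=\{x_1x_2\cdots:\ x_i\in\mathcal A\}$ the set of infinite words. The OTW full shift is the disjoint union $\Sigma_{\mathcal A}:=\mathcal A^{\mathbb N}\sqcup\Sigma_{\mathcal A}^{\mathrm{fin}}$; $|x|\in\{0,1,2,\dots,\infty\}$ denotes length. For $u\in\Sigma_{\mathcal A}^{\mathrm{fin}}$ and $x\in\Sigma_{\mathcal A}$, write $u\preceq x$ ($u$ is a prefix of $x$) if either $u=\tilde 0$, or $u=u_1\cdots u_k$ with $k\ge1$, $|x|\ge k$ and $x_1\cdots x_k=u_1\cdots u_k$. An enumeration of $\Sigma_{\mathcal A}^{\mathrm{fin}}$ is a listing $p_1,p_2,\dots$ in which each finite word appears exactly once. Given an enumeration $\mathcal P=\{p_1,p_2,\dots\}$, the associated OTW metric is defined by $d_{\mathcal P}(x,x)=0$ and, for $x\ne y$, $d_{\mathcal P}(x,y)=2^{-i}$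 where $i=\min\{j\ge1:\ \text{exactly one of } p_j\preceq x,\ p_j\preceq y \text{ holds}\}$. The shift map is regarded as a partially defined map (local homeomorphism) with domain $\mathrm{Dom}(\sigma)=\Sigma_{\mathcal A}\setminus\{\tilde 0\}$ (the elements of length at least $1$): $\sigma(x_1x_2x_3\cdots)=x_2x_3\cdots$, $\sigma(x_1\cdots x_k)=x_2\cdots x_k$ for $k\ge2$, and $\sigma(x_1)=\tilde 0$. Inductively $\mathrm{Dom}(\sigma^n)=\sigma^{-1}(\mathrm{Dom}(\sigma^{n-1}))$, so $\mathrm{Dom}(\sigma^n)=\{x:|x|\ge n\}$. An enumeration $\mathcal P=\{p_1,p_2,\dots\}$ of $\Sigma_{\mathcal A}^{\mathrm{fin}}$ is prefix--shift compatible if $p_1=\tilde 0$ and: (1) (prefix-closed) if $p_k=uv$ with $u\in\Sigma_{\mathcal A}^{\mathrm{fin}}$ and $v\in\Sigma_{\mathcal A}^{\mathrm{fin}}\setminus\{\tilde 0\}$, then $u=p_m$ for some $m<k$; (2) (shift-closed) if $|p_k|\ge2$, then $\sigma(p_k)=p_m$ for some $m<k$. For a metric $d$ on $\Sigma_{\mathcal A}$ and $\delta>0$, a sequence $(x^n)_{n\ge 0}$ in $\Sigma_{\mathcal A}$ is a $\delta$-pseudo-orbit if $x^n\in\mathrm{Dom}(\sigma)$ and $d(\sigma(x^n),x^{n+1})<\delta$ for all $n\ge0$. A point $x$ $\varepsilon$-shadows $(x^n)_{n\ge0}$ if $x\in\mathrm{Dom}(\sigma^i)$ and $d(\sigma^i(x),x^i)<\varepsilon$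 for all $i\ge0$. The Lipschitz shadowing property: there exist constants $L>0$ (a Lipschitz constant) and $\delta_0>0$ such that for every $\delta\in(0,\delta_0]$, every $\delta$-pseudo-orbit is $L\delta$-shadowed by some point of $\Sigma_{\mathcal A}$. *)

(* Defs.v *)
From mathcomp Require Import all_boot all_order all_algebra.
From mathcomp Require Import boolp classical_sets functions cardinality reals.

Set Implicit Arguments.
Unset Strict Implicit.
Unset Printing Implicit Defensive.

Import Order.TTheory GRing.Theory Num.Theory.
Local Open Scope classical_set_scope.
Local Open Scope ring_scope.

(* The OTW full shift: infinite words over [A] (letters numbered from 0) and
   finite words over [A], the empty word being [Fin [::]]. *)
Inductive otw (A : Type) : Type :=
  | Inf of (nat -> A)
  | Fin of seq A.
Arguments Inf {A}.
Arguments Fin {A}.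

(* [take (size u) w = u] forces [size u <= size w]. *)
Definition is_prefix (A : Type) (u : seq A) (x : otw A) : Prop :=
  match x with
  | Inf s => mkseq s (size u) = u
  | Fin w => take (size u) w = u
  end.

(* Enumerations are indexed from 0, so [p j] is the word usually written
   p_{j+1}; this is where the exponent [j.+1] in [otw_dist] comes from. *)
Definition enumeration (A : Type) (p : nat -> seq A) : Prop := bijective p.

Definition separates (A : Type) (p : nat -> seq A) (x y : otw A) (j : nat) :
  Prop :=
  (is_prefix (p j) x /\ ~ is_prefix (p j) y) \/
  (~ is_prefix (p j) x /\ is_prefix (p j) y).

(* The default 0 is never used when [p] is an enumeration and [x <> y]: see
   [first_separatorP]. *)
Definition first_separator (A : Type) (p : nat -> seq A) (x y : otw A) : nat :=
  xget 0%N [set j | separates p x y j /\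
                    forall k, separates p x y k -> (j <= k)%N].

Definition otw_dist (R : realType) (A : Type) (p : nat -> seq A)
    (x y : otw A) : R :=
  if `[< x = y >] then 0 else 2^-1 ^+ (first_separator p x y).+1.

Lemma separated (A : Type) (p : nat -> seq A) (x y : otw A) :
  enumeration p -> x <> y -> exists j, separates p x y j.
Proof.
case=> q _ qK xy; apply: contrapT => nsep; apply: xy.
have same u : is_prefix u x <-> is_prefix u y.
  rewrite -(qK u); set j := q u.
  case: (pselect (is_prefix (p j) x)) (pselect (is_prefix (p j) y)) =>
    [px|npx] [py|npy]; split => // _; exfalso; apply: nsep; exists j;
    by [left|right].
case: x y same {nsep} => [s|w] [t|v] /= same.
- congr Inf; apply/funext => n.
  have := (same (mkseq s n.+1)).1; rewrite size_mkseq => /(_ erefl) e.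
  by have := congr1 (fun r => nth (s n) r n) e; rewrite !nth_mkseq.
- have := (same (mkseq s (size v).+1)).1; rewrite size_mkseq => /(_ erefl).
  rewrite take_oversize // => e.
  by have := congr1 size e; rewrite size_mkseq => /n_Sn.
- have := (same (mkseq t (size w).+1)).2; rewrite size_mkseq => /(_ erefl).
  rewrite take_oversize // => e.
  by have := congr1 size e; rewrite size_mkseq => /n_Sn.
- have ew := (same w).1 (take_size w); have ev := (same v).2 (take_size v).
  case: (leqP (size v) (size w)) => le_vw.
    by move: ew; rewrite take_oversize // => ->.
  by move: ev; rewrite take_oversize 1?ltnW // => ->.
Qed.

Lemma first_separatorP (A : Type) (p : nat -> seq A) (x y : otw A) :
  enumeration p -> x <> y ->
  separates p x y (first_separator p x y) /\
  forall k, separates p x y k -> (first_separator p x y <= k)%N.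
Proof.
move=> ep xy; rewrite /first_separator.
apply: (@xgetPex _ 0%N [set j | separates p x y j /\
  forall k, separates p x y k -> (j <= k)%N]).
have ex : exists j, `[< separates p x y j >].
  by have [j ?] := separated ep xy; exists j; apply/asboolP.
exists (ex_minn ex); case: ex_minnP => m /asboolP sm min_m; split=> // k sk.
by apply: min_m; apply/asboolP.
Qed.

(* The shift is a partial map, encoded as a total function together with its
   domain; its value [Fin [::]] outside the domain is a junk value. *)
Definition shift_dom (A : Type) : set (otw A) := [set x | x <> Fin [::]].

Definition shift (A : Type) (x : otw A) : otw A :=
  match x with
  | Inf s => Inf (fun n => s n.+1)
  | Fin w => Fin (behead w)
  end.

Definition prefix_closed (A : Type) (p : nat -> seq A) : Prop :=
  forall (k : nat) (u v : seq A),
    p k = u ++ v -> v <> [::] -> exists2 m, (m < k)%N & u = p m.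

Definition shift_closed (A : Type) (p : nat -> seq A) : Prop :=
  forall k : nat, (2 <= size (p k))%N ->
    exists2 m, (m < k)%N & shift (Fin (p k)) = Fin (p m).

Definition prefix_shift_compatible (A : Type) (p : nat -> seq A) : Prop :=
  [/\ enumeration p, p 0%N = [::], prefix_closed p & shift_closed p].

(* Shadowing for a partial map on [X], given by a domain [D] and a total
   function [f] whose values outside [D] are irrelevant. *)
Section Shadowing.
Variables (R : realType) (X : Type) (D : set X) (f : X -> X) (d : X -> X -> R).

Definition iter_dom (n : nat) : set X :=
  iter n (fun E => D `&` f @^-1` E) setT.

Definition pseudo_orbit (delta : R) (xs : nat -> X) : Prop :=
  forall n, D (xs n) /\ d (f (xs n)) (xs n.+1) < delta.

Definition shadows (eps : R) (x : X) (xs : nat -> X) : Prop :=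
  forall i, iter_dom i x /\ d (iter i f x) (xs i) < eps.

Definition lipschitz_shadowing_with (L : R) : Prop :=
  exists2 delta0 : R, 0 < delta0 &
    forall delta : R, 0 < delta -> delta <= delta0 ->
    forall xs : nat -> X, pseudo_orbit delta xs ->
    exists x : X, shadows (L * delta) x xs.

Definition lipschitz_shadowing : Prop :=
  exists2 L : R, 0 < L & lipschitz_shadowing_with L.

End Shadowing.

(* Main.v *)
Require Import Defs.
From mathcomp Require Import all_boot all_order all_algebra.
From mathcomp Require Import boolp classical_sets functions cardinality reals.
Local Open Scope classical_set_scope.
Local Open Scope ring_scope.

(** Being [delta]-close means having the same prefixes among the words [p j]
    with [delta <= 2^-(j+1)] ([otw_dist_ltP]); call this finite set of words
    the window of [delta].  Since the indices in the window form an initial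
    segment and [p] is shift-closed with the empty word first, the window is
    closed under deleting the first letter.

    Given a [delta]-pseudo-orbit [xs], the shadowing point is the infinite word
    whose [i]-th letter is the first letter of [xs i].  It works because a
    nonempty word [a u] is a prefix of [xs i] exactly when [a] is the first
    letter of [xs i] and [u] is a prefix of [shift (xs i)]; when [u] is in the
    window, the pseudo-orbit condition replaces [shift (xs i)] by [xs i.+1], and
    induction on the word reads off the letters of the new point one by one
    ([is_prefix_first_letters]).  Nothing is lost in this argument, so that a
    [delta]-pseudo-orbit is even [delta]-shadowed, and the constant 2 follows
    by weakening. *)

Import Order.TTheory GRing.Theory Num.Theory.

Lemma lipschitz_shadowing_with_le (R : realType) (X : Type) (D : set X)
    (f : X -> X) (d : X -> X -> R) (L L' : R) :
  L <= L' -> lipschitz_shadowing_with D f d L ->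
  lipschitz_shadowing_with D f d L'.
Proof.
move=> leL [delta0 delta0_gt0 sh]; exists delta0 => // delta dp dle xs pxs.
have [x xP] := sh delta dp dle xs pxs; exists x => i.
have [xD xlt] := xP i; split=> //; apply: (lt_le_trans xlt).
by rewrite ler_wpM2r // ltW.
Qed.

Section OTW.
Variable A : Type.
Implicit Types (u : seq A) (x y : otw A) (s : nat -> A) (p : nat -> seq A).

Definition first_letter (a0 : A) x : A :=
  match x with Inf s => s 0%N | Fin w => head a0 w end.

Lemma is_prefix_nil x : is_prefix [::] x.
Proof. by case: x => [s|w] //=; rewrite take0. Qed.

Lemma is_prefix_cons a0 a u x : shift_dom x ->
  is_prefix (a :: u) x <-> first_letter a0 x = a /\ is_prefix u (shift x).
Proof.
case: x => [s|[|b w]] //= _; last by split=> [[-> ->]|[-> ->]].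
have -> : mkseq s (size u).+1 = s 0%N :: mkseq (fun n => s n.+1) (size u).
  by rewrite /mkseq /= -[1%N]/(1 + 0)%N iotaDl -map_comp.
by split=> [[-> ->]|[-> ->]].
Qed.

Lemma iter_shift_Inf s i : iter i (@shift A) (Inf s) = Inf (fun n => s (n + i)%N).
Proof.
elim: i => [|i IH]; first by congr Inf; apply/funext => n; rewrite addn0.
by rewrite iterS IH /=; congr Inf; apply/funext => n; rewrite addSnnS.
Qed.

Lemma iter_dom_Inf s i : iter_dom (@shift_dom A) (@shift A) i (Inf s).
Proof. by elim: i s => [|i IH] s //; split; [|apply: IH]. Qed.

(** The set [W] stands for the words that the pseudo-orbit condition controls;
    closure under [behead] is what makes the induction on [u] go through. *)
Lemma is_prefix_first_letters a0 (W : set (seq A)) (xs : nat -> otw A) :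
  (forall u, W u -> W (behead u)) ->
  (forall i, shift_dom (xs i)) ->
  (forall i u, W u -> is_prefix u (shift (xs i)) <-> is_prefix u (xs i.+1)) ->
  forall u i, W u ->
    is_prefix u (iter i (@shift A) (Inf (first_letter a0 \o xs))) <->
    is_prefix u (xs i).
Proof.
move=> Wb xsD xsW; elim=> [|a u IH] i Wau; first by split=> _; apply: is_prefix_nil.
have Wu := Wb _ Wau.
rewrite (is_prefix_cons a0 a u (xs i)) // (is_prefix_cons a0); last first.
  by rewrite iter_shift_Inf.
by rewrite -iterS (IH _ Wu) (xsW _ _ Wu) iter_shift_Inf.
Qed.

Lemma otw_dist_ltP (R : realType) p x y (delta : R) :
  enumeration p -> 0 < delta ->
  otw_dist R p x y < delta <->
  forall j, delta <= 2^-1 ^+ j.+1 -> is_prefix (p j) x <-> is_prefix (p j) y.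
Proof.
move=> ep delta_gt0; rewrite /otw_dist; case: asboolP => [->|xy] //.
have [sepm minm] := first_separatorP ep xy.
have [mlt|mge] := ltP (2^-1 ^+ (first_separator p x y).+1) delta; split=> //.
- move=> _ j jge.
  have nsep : ~ separates p x y j.
    move=> /minm lemj; have := lt_le_trans mlt jge.
    by rewrite ltNge ler_wiXn2l // ?invr_ge0 // invf_le1 ?ler1n.
  split=> pj; apply: contrapT => npj; apply: nsep; [by left|by right].
- by move=> /(_ _ mge); case: sepm => [[? n] [/(_ _)]|[n ?] [_ /(_ _)]] h;
    exfalso; apply: n; apply: h.
Qed.

(** [shift_closed] speaks of words of length at least 2 only; on shorter words
    [behead] gives the empty word, which has index 0. *)
Lemma behead_index p j : p 0%N = [::] -> shift_closed p ->
  exists2 m, (m <= j)%N & behead (p j) = p m.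
Proof.
move=> p0 psh; have [|lt2] := leqP 2 (size (p j)).
  by move=> /psh[m mj [->]]; exists m => //; apply: ltnW.
by exists 0%N => //; rewrite p0; case: (p j) lt2 => [|? []].
Qed.

Theorem otw_lipschitz_shadowing1 (R : realType) p :
  prefix_shift_compatible p ->
  lipschitz_shadowing_with (@shift_dom A) (@shift A) (@otw_dist R A p) 1.
Proof.
move=> [ep p0 _ psh]; exists 1 => // delta dp _ xs pxs; rewrite mul1r.
have xsD i : shift_dom (xs i) by have [] := pxs i.
have [a0 _] : exists a : A, True.
  by case: (xs 0%N) (xsD 0%N) => [s|[|a w]] xD; [exists (s 0%N)|case: xD|exists a].
pose W : set (seq A) := [set u | exists2 j, delta <= 2^-1 ^+ j.+1 & u = p j].
have Wb u : W u -> W (behead u).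
  move=> [j jge ->]; have [m mj ->] := behead_index p j p0 psh.
  exists m => //; apply: (le_trans jge).
  by rewrite ler_wiXn2l // ?invr_ge0 // invf_le1 ?ler1n.
have xsW i u : W u -> is_prefix u (shift (xs i)) <-> is_prefix u (xs i.+1).
  move=> [j jge ->]; have [_ /otw_dist_ltP] := pxs i.
  by move=> /(_ ep dp); apply.
exists (Inf (first_letter a0 \o xs)) => i; split; first exact: iter_dom_Inf.
apply/otw_dist_ltP => // j jge.
by apply: (is_prefix_first_letters a0 W) => //; exists j.
Qed.

End OTW.

Theorem proposition6p5 (R : realType) (A : Type)
    (hA : ([set: A] #= [set: nat])%card)
    (p : nat -> seq A) (hp : prefix_shift_compatible p) :
  lipschitz_shadowing (@shift_dom A) (@shift A) (@otw_dist R A p) /\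
  lipschitz_shadowing_with (@shift_dom A) (@shift A) (@otw_dist R A p) 2.
Proof.
have sh1 := otw_lipschitz_shadowing1 A R p hp.
by split; [exists 1|apply: lipschitz_shadowing_with_le sh1; rewrite ler1n].
Qed.
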